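(* Let $\mathcal A$ be a unital Banach algebra whose group of invertible elements is dense in $\mathcal A$ in the norm topology. Fix two elements $c, d \in \mathcal A$ and let $\phi: \mathcal A \to \mathcal A$ be a bijective continuous linear map such that $\phi(a)\phi(b) = d$ whenever $a, b \in \mathcal A$ satisfy $ab = c$. Then (1) $c = 0$ if and only if $d = 0$; and (2) $c$ is invertible if and only if $d$ is invertible.
   Context: Banach algebras are complex and associative. *)

(* Defs.v *)
From HB Require Import structures.
From mathcomp Require Import all_boot all_order all_algebra.
From mathcomp Require Import complex.
From mathcomp Require Import boolp classical_sets reals topology normedtype.

Set Implicit Arguments.
Unset Strict Implicit.
Unset Printing Implicit Defensive.

Import Order.TTheory GRing.Theory Num.Theory.
Import numFieldNormedType.Exports.

Local Open Scope ring_scope.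

(* HB rejects a join of GRing.Algebra and NormedModule declared after
   Num.NumDomain, so the multiplication is a field of the mixin and the ring
   and algebra structures are instances derived from it below.
   The normalisation `|1| = 1 is not imposed. *)
HB.mixin Record CompleteNormedModule_isBanachAlgebra (K : numFieldType) A
    & CompleteNormedModule K A := {
  banach_one : A;
  banach_mul : A -> A -> A;
  banach_mulA : associative banach_mul;
  banach_mul1r : left_id banach_one banach_mul;
  banach_mulr1 : right_id banach_one banach_mul;
  banach_mulDl : left_distributive banach_mul +%R;
  banach_mulDr : right_distributive banach_mul +%R;
  banach_oner_neq0 : banach_one != 0;
  banach_scalerAl : forall (k : K) (x y : A),
    k *: banach_mul x y = banach_mul (k *: x) y;
  banach_scalerAr : forall (k : K) (x y : A),
    k *: banach_mul x y = banach_mul x (k *: y);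
  banach_ler_normM : forall x y : A, `|banach_mul x y| <= `|x| * `|y|
}.

#[short(type="banachAlgType")]
HB.structure Definition BanachAlgebra (K : numFieldType) :=
  {A of CompleteNormedModule K A & CompleteNormedModule_isBanachAlgebra K A}.

Section BanachAlgebraInstances.
Context {K : numFieldType} {A : banachAlgType K}.

#[non_forgetful_inheritance]
HB.instance Definition _ := GRing.Zmodule_isNzRing.Build A
  (@banach_mulA K A) (@banach_mul1r K A) (@banach_mulr1 K A)
  (@banach_mulDl K A) (@banach_mulDr K A) (@banach_oner_neq0 K A).

#[non_forgetful_inheritance]
HB.instance Definition _ :=
  GRing.Lmodule_isLalgebra.Build K A (@banach_scalerAl K A).

#[non_forgetful_inheritance]
HB.instance Definition _ :=
  GRing.Lalgebra_isAlgebra.Build K A (@banach_scalerAr K A).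

Definition banach_unit : pred A :=
  fun x => `[< exists y : A, y * x = 1 /\ x * y = 1 >].

(* The value x outside the units is the MathComp convention for x^-1. *)
Definition banach_inv (x : A) : A :=
  xget x [set y : A | y * x = 1 /\ x * y = 1].

Fact banach_mulVr : {in banach_unit, left_inverse 1 banach_inv *%R}.
Proof. by move=> x /asboolP ux; case: (xgetPex x ux). Qed.

Fact banach_divrr : {in banach_unit, right_inverse 1 banach_inv *%R}.
Proof. by move=> x /asboolP ux; case: (xgetPex x ux). Qed.

Fact banach_unitP (x y : A) : y * x = 1 /\ x * y = 1 -> banach_unit x.
Proof. by move=> yx1; apply/asboolP; exists y. Qed.

Fact banach_inv_out : {in [predC banach_unit], banach_inv =1 id}.
Proof.
move=> x /negP nux; apply: xgetPN => y yx1.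
by apply: nux; apply: (@banach_unitP x y).
Qed.

#[non_forgetful_inheritance]
HB.instance Definition _ := GRing.NzRing_hasMulInverse.Build A
  banach_mulVr banach_divrr banach_unitP banach_inv_out.

End BanachAlgebraInstances.

Lemma ler_normM_banach (K : numFieldType) (A : banachAlgType K) (x y : A) :
  `|x * y| <= `|x| * `|y|.
Proof. exact: banach_ler_normM. Qed.

(* Main.v *)
Require Import Defs.
From HB Require Import structures.
From mathcomp Require Import all_boot all_order all_algebra.
From mathcomp Require Import complex.
From mathcomp Require Import boolp classical_sets reals topology normedtype.

Set Implicit Arguments.
Unset Strict Implicit.
Unset Printing Implicit Defensive.

Import Order.TTheory GRing.Theory Num.Theory.
Import numFieldNormedType.Exports.

Local Open Scope classical_set_scope.
Local Open Scope ring_scope.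
Local Open Scope complex_scope.

(** The heart of the matter is that phi carries the left ideal A c onto the
    left ideal A d.  Both equivalences follow: c = 0 iff A c = 0 iff A d = 0
    iff d = 0; and A c = A iff A d = A, where A c = A means that c has a left
    inverse, which by density of the units makes c a unit.

    To compare the two ideals, take a unit x such that phi x is a unit too.
    Then x (x^-1 c) = c gives phi (x^-1 c) = (phi x)^-1 d, an identity between
    functions of x.  Differentiating it in a direction h gives
    [phi (x^-1 h x^-1 c) = (phi x)^-1 (phi h) (phi x)^-1 d]
    ([derivative_of_inverse_product]).  As h runs over A, the arguments of phi
    on the left run over A c, and by surjectivity of phi the right-hand sides
    run over A d ([image_principal_left_ideal]).  This uses the continuity of
    phi but not that of its inverse, so the open mapping theorem is avoided.

    The analysis behind it is that the units form an open set on which the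
    inverse is continuous.  Openness is obtained from density rather than from
    a Neumann series: every point near a unit is a limit of units whose
    inverses are bounded, and by completeness such inverses converge.  This
    needs no summation of geometric series, hence works over scalar fields
    that are not archimedean. *)

(** * Limits of products and inverses *)

Lemma cvg_banachM (K : numFieldType) (A : banachAlgType K) (T : Type)
    (F : set_system T) {FF : Filter F} (f g : T -> A) (a b : A) :
  f @ F --> a -> g @ F --> b -> (fun t => f t * g t) @ F --> a * b.
Proof.
move=> fa gb; apply/cvgrPdist_le => e e0.
have Na : 0 < `|a| + 1 by rewrite ltr_wpDl.
have Nb : 0 < `|b| + 1 by rewrite ltr_wpDl.
have fbd : \forall t \near F, `|f t| <= `|a| + 1.
  by apply: cvgr_norm_le fa _ _; rewrite ltrDl.
have df : \forall t \near F, `|a - f t| <= e / 2 / (`|b| + 1).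
  by apply: cvgr_dist_le fa _ _; rewrite !divr_gt0.
have dg : \forall t \near F, `|b - g t| <= e / 2 / (`|a| + 1).
  by apply: cvgr_dist_le gb _ _; rewrite !divr_gt0.
near=> t.
have -> : a * b - f t * g t = (a - f t) * b + f t * (b - g t).
  by rewrite mulrBl mulrBr addrA subrK.
rewrite [leRHS]splitr; apply: le_trans (ler_normD _ _) _.
apply: lerD; apply: le_trans (ler_normM_banach _ _) _.
- rewrite -[leRHS](divfK (lt0r_neq0 Nb)).
  apply: ler_pM => //; first by near: t.
  by rewrite lerDl.
- rewrite -[leRHS](divfK (lt0r_neq0 Na)) mulrC.
  by apply: ler_pM => //; near: t.
Unshelve. all: by end_near. Qed.

Lemma subrVV (R : unitRingType) (x y : R) :
  x \is a GRing.unit -> y \is a GRing.unit ->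
  x^-1 - y^-1 = x^-1 * (y - x) * y^-1.
Proof. by move=> xu yu; rewrite mulrBr mulVr // mulrBl mul1r mulrK. Qed.

Lemma normV_gt0 (K : numFieldType) (A : banachAlgType K) (a : A) :
  a \is a GRing.unit -> 0 < `|a^-1|.
Proof.
by rewrite normr_gt0 invr_eq0; apply: contraTneq => ->; rewrite unitr0.
Qed.

(** For units u and a, u^-1 = a^-1 + u^-1 (a - u) a^-1; once
    |a - u| |a^-1| <= 1/2 the last term has norm at most |u^-1| / 2 and can be
    absorbed. *)
Lemma near_normV_le (K : numFieldType) (A : banachAlgType K) (a : A) :
  a \is a GRing.unit ->
  {near a, forall u : A, u \is a GRing.unit -> `|u^-1| <= 2 * `|a^-1|}.
Proof.
move=> au.
have Na := normV_gt0 au.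
have e0 : 0 < (2 * `|a^-1|)^-1 by rewrite invr_gt0 mulr_gt0.
have da : \forall u \near a, `|a - u| <= (2 * `|a^-1|)^-1.
  by apply: cvgr_dist_le (@cvg_id _ _) _ _.
near=> u => uu.
have dau : `|a - u| <= (2 * `|a^-1|)^-1 by near: u.
have bnd : `|u^-1| <= `|a^-1| + `|u^-1| / 2.
  rewrite -{1}[u^-1](subrK a^-1) subrVV // addrC.
  apply: le_trans (ler_normD _ _) _; rewrite lerD2l.
  apply: le_trans (ler_normM_banach _ _) _.
  apply: le_trans (ler_wpM2r (normr_ge0 _) (ler_normM_banach _ _)) _.
  rewrite -mulrA ler_wpM2l //.
  apply: le_trans (ler_wpM2r (normr_ge0 _) dau) _.
  by rewrite invfM -mulrA mulVf ?mulr1 // gt_eqF.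
move: bnd; rewrite -lerBlDr {1}[`|u^-1|]splitr addrK.
by rewrite ler_pdivrMr // mulrC.
Unshelve. all: by end_near. Qed.

Lemma cvg_banachV (K : numFieldType) (A : banachAlgType K) (T : Type)
    (F : set_system T) {FF : Filter F} (f : T -> A) (a : A) :
  a \is a GRing.unit -> (\forall t \near F, f t \is a GRing.unit) ->
  f @ F --> a -> (fun t => (f t)^-1) @ F --> a^-1.
Proof.
move=> au fu fa; apply/cvgrPdist_le => e e0.
pose m := `|a^-1|.
have m0 : 0 < m by exact: normV_gt0.
have fb : \forall t \near F, f t \is a GRing.unit -> `|(f t)^-1| <= 2 * m.
  exact: (fa _ (near_normV_le au)).
have df : \forall t \near F, `|a - f t| <= e / (2 * m) / m.
  by apply: cvgr_dist_le fa _ _; rewrite !divr_gt0 // mulr_gt0.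
near=> t.
have ftu : f t \is a GRing.unit by near: t.
have ftb : `|(f t)^-1| <= 2 * m by move: ftu; near: t.
have m20 : 2 * m != 0 by rewrite lt0r_neq0 // mulr_gt0.
rewrite subrVV // -[e](divfK m20) -[e / _](divfK (lt0r_neq0 m0)).
apply: le_trans (ler_normM_banach _ _) _; apply: ler_pM => //.
apply: le_trans (ler_normM_banach _ _) _; rewrite mulrC; apply: ler_pM => //.
by rewrite distrC; near: t.
Unshelve. all: by end_near. Qed.

(** * Units when the units are dense *)

(** Since v^-1 - u^-1 = v^-1 (u - v) u^-1, a bound on the inverses makes them a
    Cauchy filter; its limit is inverse to x by continuity of the product. *)
Lemma unit_of_cvg_bounded_inverses (K : numFieldType) (A : banachAlgType K)
    (F : set_system A) (FF : ProperFilter F) (x : A) (M : K) :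
  F --> x ->
  {near F, forall u : A, u \is a GRing.unit /\ `|u^-1| <= M} ->
  x \is a GRing.unit.
Proof.
move=> Fx FM.
have [u0 [_ u0M]] := filter_ex FM.
have M0 : 0 <= M by apply: le_trans u0M.
have M1 : 0 < M + 1 by rewrite ltr_wpDl.
have : cvg (GRing.inv @ F).
  apply/cauchy_cvgP; apply: cauchy_exP => e e0.
  pose s := e / (M + 1) / (M + 1).
  have s0 : 0 < s by rewrite !divr_gt0.
  have Fs : \forall u \near F, `|x - u| < s / 2.
    by apply: cvgr_dist_lt Fx _ _; rewrite divr_gt0.
  have [v [[vu vM] xv]] := filter_ex (filterI FM Fs).
  (* Makes u range over the units near x rather than over their inverses. *)
  exists v^-1; suff : {near F, forall u : A, ball v^-1 e u^-1} by [].
  near=> u.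
  have [uu uM] : u \is a GRing.unit /\ `|u^-1| <= M by near: u.
  have xu : `|x - u| < s / 2 by near: u.
  have uv : `|u - v| < s.
    rewrite [s]splitr; apply: le_lt_trans (ler_distD x _ _) _.
    by rewrite ltrD // distrC.
  rewrite -ball_normE /= subrVV //.
  rewrite -[e](divfK (lt0r_neq0 M1)) -[e / _](divfK (lt0r_neq0 M1)) -/s.
  apply: le_lt_trans (ler_normM_banach _ _) _.
  apply: ltr_pM => //; last by apply: le_lt_trans uM _; rewrite ltrDl.
  apply: le_lt_trans (ler_normM_banach _ _) _; rewrite mulrC.
  by apply: ltr_pM => //; apply: le_lt_trans vM _; rewrite ltrDl.
case/cvg_ex => l Gl.
apply/unitrP; exists l; split.
  have lx : t^-1 * t @[t --> F] --> l * x by apply: cvg_banachM.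
  apply: (norm_cvg_unique lx).
  apply: cvg_near_cst; near=> u.
  have [uu _] : u \is a GRing.unit /\ `|u^-1| <= M by near: u.
  by rewrite mulVr.
have xl : t * t^-1 @[t --> F] --> x * l by apply: cvg_banachM.
apply: (norm_cvg_unique xl).
apply: cvg_near_cst; near=> u.
have [uu _] : u \is a GRing.unit /\ `|u^-1| <= M by near: u.
by rewrite mulrV.
Unshelve. all: by end_near. Qed.

Lemma dense_near_ex (T : topologicalType) (S : set T) (p : T) (P : set T) :
  dense S -> nbhs p P -> exists2 x, S x & P x.
Proof.
rewrite nbhsE => dS [O [oO Op] OP].
have [x [Ox Sx]] := dS O (ex_intro _ p Op) oO.
by exists x => //; apply: OP.
Qed.

(** The bound on inverses of units holds on a neighbourhood of a, and any x in
    it is a limit of units by density. *)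
Lemma near_unit (K : numFieldType) (A : banachAlgType K) (a : A) :
  dense [set u : A | u \is a GRing.unit] ->
  a \is a GRing.unit -> \forall x \near a, x \is a GRing.unit.
Proof.
move=> dU au; near=> x.
have bx : {near x, forall u : A, u \is a GRing.unit -> `|u^-1| <= 2 * `|a^-1|}.
  by near: x; apply: near_join; apply: near_normV_le.
have PF : ProperFilter (within [set u : A | u \is a GRing.unit] (nbhs x)).
  apply: within_nbhs_proper => B /(dense_near_ex dU)[y].
  by exists y.
apply: (@unit_of_cvg_bounded_inverses _ _ _ PF x (2 * `|a^-1|)).
  exact: cvg_within.
rewrite near_withinE; near=> u => /= uu; split=> //.
by move: uu; near: u.
Unshelve. all: by end_near. Qed.

(** If u is a unit close to the left inverse k of c, then u c is close to 1,
    hence a unit, and so is c = u^-1 (u c). *)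
Lemma unit_of_left_inverse (K : numFieldType) (A : banachAlgType K) (c k : A) :
  dense [set u : A | u \is a GRing.unit] -> k * c = 1 -> c \is a GRing.unit.
Proof.
move=> dU kc.
have nk : \forall u \near k, u * c \is a GRing.unit.
  have : (fun u => u * c) @ k --> k * c.
    exact: cvg_banachM (@cvg_id _ _) (cvg_cst _).
  by move=> /(_ _ (near_unit dU _)); apply; rewrite kc unitr1.
have [u uu] := dense_near_ex dU nk.
by rewrite unitrMr.
Qed.

(** * Principal left ideals *)

(** The two sides are the derivatives in the direction h, up to sign, of the
    functions phi (x^-1 c) and (phi x)^-1 d, which agree near x.  The proof
    compares them at x and at y = x + t h, where
    x^-1 - y^-1 = t (x^-1 h y^-1) allows the exact cancellation of t before
    passing to the limit. *)
Lemma derivative_of_inverse_product (K : numFieldType) (A : banachAlgType K)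
    (phi : {linear A -> A}) (c d x h : A) :
  dense [set u : A | u \is a GRing.unit] ->
  continuous phi ->
  (forall a b : A, a * b = c -> phi a * phi b = d) ->
  x \is a GRing.unit -> phi x \is a GRing.unit ->
  phi (x^-1 * h * x^-1 * c) = (phi x)^-1 * phi h * (phi x)^-1 * d.
Proof.
move=> dU phic phiM xu pxu.
have phiV y : y \is a GRing.unit -> phi y \is a GRing.unit ->
    phi (y^-1 * c) = (phi y)^-1 * d.
  by move=> yu pyu; rewrite -(phiM y (y^-1 * c)) ?mulKr // mulVKr.
pose y (t : K) := x + t *: h.
have yBx t : y t - x = t *: h by rewrite /y addrC addKr.
have y_x : y @ 0^' --> x.
  rewrite -[X in _ --> X]addr0 -[X in x + X](scale0r h).
  apply: cvgD; first exact: cvg_cst.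
  by apply: cvgZr_tmp; apply: nbhs_dnbhs.
have py_px : (phi \o y) @ 0^' --> phi x by apply: cvg_comp y_x (phic x).
have yu : \forall t \near 0^', y t \is a GRing.unit.
  exact: (y_x _ (near_unit dU xu)).
have pyu : \forall t \near 0^', phi (y t) \is a GRing.unit.
  exact: (py_px _ (near_unit dU pxu)).
have L0 : x^-1 * h * (y t)^-1 * c @[t --> 0^'] --> x^-1 * h * x^-1 * c.
  apply: cvg_banachM; last exact: cvg_cst.
  by apply: cvg_banachM; [exact: cvg_cst | exact: cvg_banachV].
have L := cvg_comp _ _ L0 (phic _).
have Rt : (fun t => (phi x)^-1 * phi h * (phi (y t))^-1 * d) @ 0^' -->
    (phi x)^-1 * phi h * (phi x)^-1 * d.
  apply: cvg_banachM; last exact: cvg_cst.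
  by apply: cvg_banachM; [exact: cvg_cst | exact: cvg_banachV].
apply: (@norm_cvg_unique K A _ _ _ _ L); apply: cvg_trans Rt.
apply: near_eq_cvg; near=> t.
have t0 : t != 0 by near: t; apply: nbhs_dnbhs_neq.
have ytu : y t \is a GRing.unit by near: t.
have pytu : phi (y t) \is a GRing.unit by near: t.
apply: (scalerI t0).
transitivity (((phi x)^-1 - (phi (y t))^-1) * d).
  rewrite subrVV // -linearB yBx linearZ.
  by rewrite -scalerAr -!scalerAl.
rewrite mulrBl -!phiV // -linearB -mulrBl subrVV //.
by rewrite yBx -scalerAr -!scalerAl linearZ.
Unshelve. all: by end_near. Qed.

(** The preimage of the open set of units is open and contains the preimage of
    1, so it meets the dense set of units. *)
Lemma exists_unit_image (K : numFieldType) (A : banachAlgType K)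
    (phi : {linear A -> A}) :
  dense [set u : A | u \is a GRing.unit] ->
  continuous phi -> bijective phi ->
  exists2 x : A, x \is a GRing.unit & phi x \is a GRing.unit.
Proof.
move=> dU phic [psi _ psiK].
have : \forall x \near psi 1, phi x \is a GRing.unit.
  by apply: (phic (psi 1) _ (near_unit dU _)); rewrite psiK unitr1.
by move/(dense_near_ex dU).
Qed.

(** In the derivative identity, the choice h = x k x makes the argument of phi
    equal to k c, and the choice phi h = phi x k phi x makes the right-hand
    side equal to k d. *)
Lemma image_principal_left_ideal (K : numFieldType) (A : banachAlgType K)
    (phi : {linear A -> A}) (c d : A) :
  dense [set u : A | u \is a GRing.unit] ->
  continuous phi -> bijective phi ->
  (forall a b : A, a * b = c -> phi a * phi b = d) ->
  forall v : A, (exists k, v = k * c) <-> (exists k, phi v = k * d).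
Proof.
move=> dU phic phib phiM v.
have [x xu pxu] := exists_unit_image dU phic phib.
have E h := derivative_of_inverse_product h dU phic phiM xu pxu.
have [psi phiK psiK] := phib.
split=> -[k].
  move=> ->; exists ((phi x)^-1 * phi (x * k * x) * (phi x)^-1).
  by rewrite -E !mulrA mulVr // mul1r mulrK.
move=> vE; exists (x^-1 * psi (phi x * k * phi x) * x^-1).
by apply: (can_inj phiK); rewrite E psiK !mulrA mulVr // mul1r mulrK.
Qed.

Theorem theorem3p3 (R : realType) (A : banachAlgType R[i])
    (inv_dense : dense [set a : A | a \is a GRing.unit])
    (c d : A) (phi : {linear A -> A})
    (phi_bij : bijective phi) (phi_cont : continuous phi)
    (phi_prod : forall a b : A, a * b = c -> phi a * phi b = d) :
  (c = 0 <-> d = 0) /\ (c \is a GRing.unit <-> d \is a GRing.unit).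
Proof.
have ideal := image_principal_left_ideal inv_dense phi_cont phi_bij phi_prod.
have [psi phiK psiK] := phi_bij.
split; split.
- move=> c0; have [|k] := (ideal (psi d)).2.
    by exists 1; rewrite psiK mul1r.
  by rewrite c0 mulr0 => psid; rewrite -(psiK d) psid linear0.
- move=> d0; have [|k] := (ideal c).1; first by exists 1; rewrite mul1r.
  by rewrite d0 mulr0 => pc; apply: (can_inj phiK); rewrite pc linear0.
- move=> cu; have [|k] := (ideal (psi 1)).1.
    by exists (psi 1 * c^-1); rewrite divrK.
  by rewrite psiK => /esym /(unit_of_left_inverse inv_dense).
- move=> du; have [|k] := (ideal 1).2.
    by exists (phi 1 * d^-1); rewrite divrK.
  by move=> /esym /(unit_of_left_inverse inv_dense).
Qed.
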